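(* Linear optimization over the packing orbitope $O^{\le}_{p,q}$ can be solved in time $O(pq)$: there is an algorithm that, given integers $p\ge q\ge 1$ and an objective vector $d\in\mathbb{R}^{\mathcal{I}_{p,q}}$, computes in time $O(pq)$ an optimal solution of $\max\{\langle d,x\rangle : x\in O^{\le}_{p,q}\}$.
   Context: Notation: $[n]=\{1,\dots,n\}$, $\mathcal{I}_{p,q}=\{(i,j)\in[p]\times[q] : i\ge j\}$. The packing orbitope $O^{\le}_{p,q}$ is the convex hull of all 0/1-matrices of size $p\times q$ whose columns are in lexicographically decreasing (i.e., non-increasing, with row 1 the most significant position) order and that have at most one 1-entry per row. Since no such matrix has a 1 above its main diagonal, the entries $(i,j)$ with $i<j$ are dropped and $O^{\le}_{p,q}$ is regarded as a subset of $\mathbb{R}^{\mathcal{I}_{p,q}}$. Time is measured as the number of elementary operations, where arithmetic operations on and comparisons of real numbers have unit cost. *)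

(* Defs.v *)
(* Rows and columns are indexed from 0 ('I_p and 'I_q), so that the pairs
   (i, j) with i >= j are the same as with indices from 1. *)
From HB Require Import structures.
From mathcomp Require Import all_boot all_order all_algebra.
From mathcomp Require Import classical_sets reals convex.

Set Implicit Arguments.
Unset Strict Implicit.
Unset Printing Implicit Defensive.

Import Order.TTheory GRing.Theory Num.Theory.
Local Open Scope classical_set_scope.
Local Open Scope ring_scope.

(** * The packing orbitope *)

Definition cell (p q : nat) := {ij : 'I_p * 'I_q | (ij.2 <= ij.1)%N}.

(* The type [p.-tuplelexi R] carries the lexicographic order in which
   component 0, here the entry in the topmost row, is the most significant. *)
Definition column (R : realType) (p q : nat) (X : 'M[R]_(p, q)) (j : 'I_q) :
  p.-tuplelexi R := [tuple X i j | i < p].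

Definition packing_matrix (R : realType) (p q : nat) (X : 'M[R]_(p, q)) :
    Prop :=
  [/\ forall i j, X i j = 0 \/ X i j = 1,
      forall j k : 'I_q, (j <= k)%N -> (column X k <= column X j)%O
    & forall i, (#|[set j | X i j == 1%R]%SET| <= 1)%N].

Definition convex_hull (R : realType) (V : lmodType R) (A : set V) : set V :=
  smallest (@convex_set R V) A.

Definition restrict (R : realType) (p q : nat) (X : 'M[R]_(p, q)) :
  {ffun cell p q -> R} := [ffun c => X (val c).1 (val c).2].

(* All entries (i, j) with i < j vanish on the convex hull, so that [restrict]
   only forgets zeros. *)
Definition packing_orbitope (R : realType) (p q : nat) :
    set {ffun cell p q -> R} :=
  @restrict R p q @` convex_hull [set X | packing_matrix X].

Arguments packing_orbitope R p q : clear implicits.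

Definition inner (R : realType) (p q : nat) (d x : {ffun cell p q -> R}) : R :=
  \sum_c d c * x c.

Definition maximizes (R : realType) (p q : nat) (d : {ffun cell p q -> R})
    (P : set {ffun cell p q -> R}) (x : {ffun cell p q -> R}) : Prop :=
  P x /\ forall y, P y -> inner d y <= inner d x.

(** * Algorithms

  An algorithm is a while-program on a random access machine with real
  numbers. The memory has scalar variables and one-dimensional arrays, named
  by natural numbers, of natural numbers (used for control and indexing) and
  of real numbers. A program is a finite text that does not depend on the
  size of the input, and its only real constants are 0 and 1. There is no
  operation from reals to naturals (no rounding) and no multiplication of
  naturals, so that unit costs do not hide any computation. *)

Inductive nexp : Type :=
| NConst of nat
| NVar of nat
| NGet of nat & nexp
| NAdd of nexp & nexp
| NSub of nexp & nexp.

Inductive rexp : Type :=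
| RZero
| ROne
| RVar of nat
| RGet of nat & nexp
| RAdd of rexp & rexp
| RSub of rexp & rexp
| RMul of rexp & rexp
| RDiv of rexp & rexp.

Inductive bexp : Type :=
| NLe of nexp & nexp
| RLe of rexp & rexp
| BNot of bexp
| BAnd of bexp & bexp.

Inductive cmd : Type :=
| Skip
| NSet of nat & nexp
| NPut of nat & nexp & nexp
| RSet of nat & rexp
| RPut of nat & nexp & rexp
| Seq of cmd & cmd
| If of bexp & cmd & cmd
| While of bexp & cmd.

Record state (R : realType) := State {
  nvar : nat -> nat;
  narr : nat -> nat -> nat;
  rvar : nat -> R;
  rarr : nat -> nat -> R
}.

(* Subtraction of naturals is truncated, and division by zero yields 0. *)
Fixpoint neval (R : realType) (s : state R) (e : nexp) : nat :=
  match e with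
  | NConst n => n
  | NVar x => nvar s x
  | NGet a e => narr s a (neval s e)
  | NAdd e f => (neval s e + neval s f)%N
  | NSub e f => (neval s e - neval s f)%N
  end.

Fixpoint reval (R : realType) (s : state R) (e : rexp) : R :=
  match e with
  | RZero => 0
  | ROne => 1
  | RVar x => rvar s x
  | RGet a e => rarr s a (neval s e)
  | RAdd e f => reval s e + reval s f
  | RSub e f => reval s e - reval s f
  | RMul e f => reval s e * reval s f
  | RDiv e f => reval s e / reval s f
  end.

Fixpoint beval (R : realType) (s : state R) (b : bexp) : bool :=
  match b with
  | NLe e f => (neval s e <= neval s f)%N
  | RLe e f => reval s e <= reval s f
  | BNot b => ~~ beval s b
  | BAnd b c => beval s b && beval s c
  end.

(* Every node of an expression (constant, memory access, arithmetic operation,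
   comparison, connective) is one elementary operation. *)
Fixpoint ncost (e : nexp) : nat :=
  match e with
  | NConst _ | NVar _ => 1
  | NGet _ e => (ncost e).+1
  | NAdd e f | NSub e f => (ncost e + ncost f).+1
  end.

Fixpoint rcost (e : rexp) : nat :=
  match e with
  | RZero | ROne | RVar _ => 1
  | RGet _ e => (ncost e).+1
  | RAdd e f | RSub e f | RMul e f | RDiv e f => (rcost e + rcost f).+1
  end.

Fixpoint bcost (b : bexp) : nat :=
  match b with
  | NLe e f => (ncost e + ncost f).+1
  | RLe e f => (rcost e + rcost f).+1
  | BNot b => (bcost b).+1
  | BAnd b c => (bcost b + bcost c).+1
  end.

Definition upd (T : Type) (f : nat -> T) (k : nat) (v : T) : nat -> T :=
  fun l => if l == k then v else f l.

Definition set_nvar (R : realType) (s : state R) (x n : nat) : state R :=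
  State (upd (nvar s) x n) (narr s) (rvar s) (rarr s).

Definition set_narr (R : realType) (s : state R) (a i n : nat) : state R :=
  State (nvar s) (upd (narr s) a (upd (narr s a) i n)) (rvar s) (rarr s).

Definition set_rvar (R : realType) (s : state R) (x : nat) (r : R) : state R :=
  State (nvar s) (narr s) (upd (rvar s) x r) (rarr s).

Definition set_rarr (R : realType) (s : state R) (a i : nat) (r : R) :
    state R :=
  State (nvar s) (narr s) (rvar s) (upd (rarr s) a (upd (rarr s a) i r)).

(* [exec c s t s']: started in [s], the program [c] terminates in [s'] after
   [t] elementary operations. *)
Inductive exec (R : realType) : cmd -> state R -> nat -> state R -> Prop :=
| exec_Skip s :
    exec Skip s 1 s
| exec_NSet x e s :
    exec (NSet x e) s (ncost e).+1 (set_nvar s x (neval s e))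
| exec_NPut a i e s :
    exec (NPut a i e) s (ncost i + ncost e).+1
      (set_narr s a (neval s i) (neval s e))
| exec_RSet x e s :
    exec (RSet x e) s (rcost e).+1 (set_rvar s x (reval s e))
| exec_RPut a i e s :
    exec (RPut a i e) s (ncost i + rcost e).+1
      (set_rarr s a (neval s i) (reval s e))
| exec_Seq c1 c2 s1 s2 s3 t1 t2 :
    exec c1 s1 t1 s2 -> exec c2 s2 t2 s3 ->
    exec (Seq c1 c2) s1 (t1 + t2) s3
| exec_If b c1 c2 s s' t :
    exec (if beval s b then c1 else c2) s t s' ->
    exec (If b c1 c2) s (bcost b + t).+1 s'
| exec_WhileF b c s :
    ~~ beval s b -> exec (While b c) s (bcost b).+1 s
| exec_WhileT b c s1 s2 s3 t1 t2 :
    beval s1 b -> exec c s1 t1 s2 -> exec (While b c) s2 t2 s3 ->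
    exec (While b c) s1 (bcost b + t1 + t2).+1 s3.

(* Final state and running time are functions of the initial state. *)
Lemma exec_det (R : realType) (c : cmd) (s s1 s2 : state R) (t1 t2 : nat) :
  exec c s t1 s1 -> exec c s t2 s2 -> t1 = t2 /\ s1 = s2.
Proof.
move=> E; elim: E t2 s2 => {c s t1 s1};
  try by move=> *; match goal with H : exec _ _ _ _ |- _ => inversion H end.
- move=> c1 c2 s1 s2 s3 t1 t2 _ IH1 _ IH2 u s F.
  inversion F as [| | | | |? ? ? ? ? ? ? F1 F2| | |]; subst.
  by case: (IH1 _ _ F1) => -> ?; subst; case: (IH2 _ _ F2) => -> ->.
- move=> b c1 c2 s s' t _ IH u s2 F.
  inversion F as [| | | | | |? ? ? ? ? ? F1| |]; subst.
  by case: (IH _ _ F1) => -> ->.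
- move=> b c s /negP nb u s2 F.
  by inversion F as [| | | | | | | |? ? ? ? ? ? ? sb]; subst.
- move=> b c s1 s2 s3 t1 t2 sb _ IH1 _ IH2 u s F.
  inversion F as [| | | | | | |? ? ? nb|? ? ? ? ? ? ? _ F1 F2]; subst.
    by rewrite sb in nb.
  by case: (IH1 _ _ F1) => -> ?; subst; case: (IH2 _ _ F2) => -> ->.
Qed.

(** * Input and output *)

(* Vectors indexed by cells are stored in row-major order, as in a p x q array
   whose positions above the diagonal are unused. *)
Definition offset (p q : nat) (c : cell p q) : nat :=
  ((val c).1 * q + (val c).2)%N.

(* The rest of the memory is arbitrary. *)
Definition is_input (R : realType) (p q : nat) (d : {ffun cell p q -> R})
    (s : state R) : Prop :=
  [/\ nvar s 0 = p, nvar s 1 = q & forall c, rarr s 0 (offset c) = d c].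

Definition output (R : realType) (p q : nat) (s : state R) :
  {ffun cell p q -> R} := [ffun c => rarr s 1 (offset c)].

(* Main.v *)
(* Columns of a packing matrix have disjoint supports, so they are in
   lexicographic order if and only if the topmost 1-entries of the nonzero
   columns lie in increasing rows and the zero columns come last. Reading the
   matrix from top to bottom, a row that follows rows whose 1-entries occupy the
   first k columns is therefore zero, or has its 1-entry in one of these k
   columns, or opens column k + 1. The largest gain of the rows from i on is
   thus a function of i and k. Within a row, the best of the first k columns is
   a running maximum, so each of the p (q + 1) values takes constant time; the
   solution is read off from the recorded decisions. Objective entries above
   the diagonal are never reached from k = 0, so arbitrary memory contents there
   do no harm. *)
Require Import Defs.
From mathcomp Require Import all_boot all_order all_algebra.
From mathcomp Require Import classical_sets reals convex.
From mathcomp Require Import boolp interval_inference zify.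

Set Implicit Arguments.
Unset Strict Implicit.
Unset Printing Implicit Defensive.

Import Order.TTheory GRing.Theory Num.Theory.
Local Open Scope ring_scope.

(** * Dynamic programming *)

(* A packing matrix is encoded by [r : nat -> nat]: [r i] is [0] if row [i]
   vanishes and [j.+1] if its 1-entry is in column [j]. *)
Fixpoint used (r : nat -> nat) (i : nat) : nat :=
  if i is i'.+1 then maxn (used r i') (r i') else 0.

(** With 0 as an extra value for empty rows, these are the restricted growth functions that encode
    set partitions: a row is empty, reuses an opened column, or opens the next one while fewer than
    [q] are open. *)
Definition restricted_growth (p q : nat) (r : nat -> nat) : Prop :=
  forall i, (i < p)%N -> (r i <= minn (used r i).+1 q)%N.

Definition gain (R : realType) (w : nat -> R) (r : nat) : R :=
  if r is j.+1 then w j else 0.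

(** The choice 0, an empty row of gain 0, competes with the columns. Ties go to the later column, as
    in the test made by the program. *)
Fixpoint best_used (R : realType) (w : nat -> R) (k : nat) : nat :=
  if k is k'.+1 then
    if gain w (best_used w k') <= w k' then k else best_used w k'
  else 0.

(* [U] is the value function of the remaining rows and [k] is the number of
   columns used so far. *)
Definition best_row (R : realType) (q : nat) (w U : nat -> R) (k : nat) : nat :=
  if (k < q)%N && (U k + gain w (best_used w k) <= U k.+1 + w k) then k.+1
  else best_used w k.

Definition bellman (R : realType) (q : nat) (w U : nat -> R) (k : nat) : R :=
  U (maxn k (best_row q w U k)) + gain w (best_row q w U k).

(* [n] is the number of remaining rows, so that [w (p - n)] is the next row. *)
Fixpoint value (R : realType) (p q : nat) (w : nat -> nat -> R) (n : nat) :
    nat -> R :=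
  if n is n'.+1 then bellman q (w (p - n)%N) (value p q w n') else fun=> 0.

(** With [n] rows below it, the row to be decided is [p - n.+1]; row [i] is therefore addressed by
    [n = p - i.+1]. *)
Definition policy (R : realType) (p q : nat) (w : nat -> nat -> R)
    (n : nat) : nat -> nat :=
  best_row q (w (p - n.+1)%N) (value p q w n).

Fixpoint opt_used (R : realType) (p q : nat) (w : nat -> nat -> R) (i : nat) :
    nat :=
  if i is i'.+1 then
    let k := opt_used p q w i' in maxn k (policy p q w (p - i) k)
  else 0.

Definition opt_row (R : realType) (p q : nat) (w : nat -> nat -> R) (i : nat) :
    nat :=
  policy p q w (p - i.+1) (opt_used p q w i).

(** * Optimality of the recorded decisions *)

Lemma best_used_le (R : realType) (w : nat -> R) k : (best_used w k <= k)%N.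
Proof. by elim: k => //= k IH; case: ifP => // _; apply: leqW. Qed.

Lemma gain_best_used (R : realType) (w : nat -> R) k r :
  (r <= k)%N -> gain w r <= gain w (best_used w k).
Proof.
elim: k r => [|k IH] r /=; first by rewrite leqn0 => /eqP ->.
rewrite leq_eqVlt => /predU1P[->|/IH le_r];
  case: (leP (gain w (best_used w k)) (w k)) => //.
- by move/ltW.
- exact: le_trans.
Qed.

Lemma best_row_le (R : realType) q (w U : nat -> R) k :
  (k <= q)%N -> (best_row q w U k <= minn k.+1 q)%N.
Proof.
rewrite /best_row => le_kq; case: ifP => [/andP[lt_kq _]|_].
  by rewrite leq_min leqnn.
have := best_used_le w k; lia.
Qed.

(** A choice [r <= k] leaves [k] columns used, so only its gain counts and the running maximum wins.
    The one other choice is [k.+1], with which [best_row] compares explicitly. *)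
Lemma bellman_ge (R : realType) q (w U : nat -> R) k r :
  (r <= minn k.+1 q)%N -> U (maxn k r) + gain w r <= bellman q w U k.
Proof.
have best_max : maxn k (best_used w k) = k by have := best_used_le w k; lia.
have top_max : maxn k k.+1 = k.+1 by lia.
rewrite leq_min leq_eqVlt /bellman /best_row => /andP[/predU1P[->|lt_rk] le_rq].
  rewrite le_rq /=; case: (leP (U k + gain w (best_used w k)) (U k.+1 + w k)).
    by [].
  by move/ltW; rewrite best_max top_max.
have -> : maxn k r = k by lia.
apply: (@le_trans _ _ (U k + gain w (best_used w k))).
  by rewrite lerD2l gain_best_used.
by case: ifP => [/andP[_]|_]; rewrite ?best_max ?top_max.
Qed.

Lemma used_opt_row (R : realType) p q (w : nat -> nat -> R) i :
  used (opt_row p q w) i = opt_used p q w i.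
Proof. by elim: i => //= i ->. Qed.

(** Each row opens at most one column. Hence the column chosen in row [i] is at most [i], and no
    1-entry lies above the diagonal. *)
Lemma used_le_index p q r i :
  restricted_growth p q r -> (i <= p)%N -> (used r i <= i)%N.
Proof.
move=> gr; elim: i => //= i IH lt_ip.
by have := gr _ lt_ip; have := IH (ltnW lt_ip); lia.
Qed.

Lemma opt_used_le (R : realType) p q (w : nat -> nat -> R) i :
  (opt_used p q w i <= q)%N.
Proof.
elim: i => //= i IH; rewrite geq_max IH /=.
apply: leq_trans (best_row_le _ _ IH) _; exact: geq_minr.
Qed.

Lemma opt_row_growth (R : realType) p q (w : nat -> nat -> R) :
  restricted_growth p q (opt_row p q w).
Proof.
by move=> i _; rewrite used_opt_row; apply/best_row_le/opt_used_le.
Qed.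

Lemma value_step (R : realType) p q (w : nat -> nat -> R) i k : (i < p)%N ->
  value p q w (p - i) k = bellman q (w i) (value p q w (p - i.+1)) k.
Proof.
move=> lt_ip; have -> : (p - i = (p - i.+1).+1)%N by lia.
by congr (bellman _ (w _) _ _); lia.
Qed.

(** Past gain plus best future gain cannot increase with [i], since each decision is dominated by
    the Bellman maximum. *)
Lemma growth_le_value (R : realType) p q (w : nat -> nat -> R) r i :
  restricted_growth p q r -> (i <= p)%N ->
  value p q w (p - i) (used r i) + \sum_(l < i) gain (w l) (r l)
    <= value p q w p 0.
Proof.
move=> gr; elim: i => [|i IH] lt_ip; first by rewrite big_ord0 addr0 subn0.
apply: le_trans (IH (ltnW lt_ip)).
rewrite big_ord_recr /= addrCA addrC lerD2r (value_step _ _ _ lt_ip).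
by apply: bellman_ge; apply: gr.
Qed.

(** The recorded decisions attain each Bellman maximum, so the same potential stays constant. At
    [i = p] no future gain is left and the potential is the total gain. *)
Lemma opt_row_value (R : realType) p q (w : nat -> nat -> R) i : (i <= p)%N ->
  value p q w (p - i) (opt_used p q w i)
    + \sum_(l < i) gain (w l) (opt_row p q w l) = value p q w p 0.
Proof.
elim: i => [|i IH] lt_ip; first by rewrite big_ord0 addr0 subn0.
rewrite -(IH (ltnW lt_ip)) big_ord_recr /= addrCA addrC.
rewrite (value_step _ _ _ lt_ip).
rewrite /bellman /opt_row /policy.
by have -> : (p - (p - i.+1).+1 = i)%N by lia.
Qed.

Lemma opt_row_optimal (R : realType) p q (w : nat -> nat -> R) r :
  restricted_growth p q r ->
  \sum_(i < p) gain (w i) (r i) <= \sum_(i < p) gain (w i) (opt_row p q w i).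
Proof.
move=> /(growth_le_value w) /(_ (leqnn p)).
by rewrite -(opt_row_value q w (leqnn p)) subnn /= !add0r.
Qed.

(** * Packing matrices *)

Definition row_mx_of (R : realType) (p q : nat) (r : nat -> nat) :
  'M[R]_(p, q) := \matrix_(i, j) (r i == j.+1)%:R.

(** The counter grows by at most one per row, so no column is skipped. *)
Lemma used_witness p q r i j : restricted_growth p q r -> (i <= p)%N ->
  (j < used r i)%N -> exists2 l, (l < i)%N & r l = j.+1.
Proof.
move=> gr; elim: i => //= i IH lt_ip lt_j.
case: (ltnP j (used r i)) => [/(IH (ltnW lt_ip))[l lt_li rl]|ge_j].
  by exists l => //; apply: leqW.
by exists i => //; have := gr _ lt_ip; lia.
Qed.

Lemma used_ge r i l : (l < i)%N -> (r l <= used r i)%N.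
Proof.
elim: i => //= i IH; rewrite ltnS leq_eqVlt => /predU1P[->|/IH]; lia.
Qed.

(** For [j < k], column [k] can be opened only after column [j]. So either both columns vanish, or
    the topmost 1-entry of column [j] decides the comparison. *)
Lemma row_mx_of_packing (R : realType) p q r :
  restricted_growth p q r -> packing_matrix (row_mx_of R p q r).
Proof.
move=> gr; split=> [i j|j k|i].
- by rewrite mxE; case: eqP; [right|left].
- rewrite leq_eqVlt => /predU1P[/val_inj -> //|lt_jk].
  have [[i rij]|no_j] := pselect (exists i : 'I_p, r i = j.+1); last first.
    suff -> : column (row_mx_of R p q r) k = column (row_mx_of R p q r) j by [].
    apply: eq_from_tnth => i; rewrite !tnth_mktuple !mxE.
    have /eqP/negbTE -> : r i <> j.+1 by move=> rij; case: no_j; exists i.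
    case: eqP => // rik; have := gr _ (ltn_ord i).
    rewrite rik leq_min => /andP[le_ku _].
    have [l lt_li rl] :=
      used_witness gr (ltnW (ltn_ord i)) (leq_trans lt_jk le_ku).
    by case: no_j; exists (Ordinal (ltn_trans lt_li (ltn_ord i))).
  pose hits (l : 'I_p) := r l == j.+1.
  have /(@arg_minnP _ i hits val)[f /eqP rfj min_f] : hits i by apply/eqP.
  (* A 1-entry of column [k] in a row up to [f] would force one of column [j] strictly above [f],
     against the minimality of [f]. *)
  have k0 (l : 'I_p) : (l <= f)%N -> r l != k.+1.
    move=> le_lf; apply/eqP => rlk.
    have := gr _ (ltn_ord l); rewrite rlk leq_min => /andP[le_ku _].
    have [l' lt_l' rl'] :=
      used_witness gr (ltnW (ltn_ord l)) (leq_trans lt_jk le_ku).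
    have := min_f (Ordinal (ltn_trans lt_l' (ltn_ord l))) (introT eqP rl').
    by move=> /=; lia.
  apply/ltW/ltxi_tuplePlt; exists f => [l lt_lf|].
    rewrite !tnth_mktuple !mxE (negbTE (k0 _ (ltnW lt_lf))).
    by case: eqP => // rlj; have /= := min_f l (introT eqP rlj); lia.
  by rewrite !tnth_mktuple !mxE (negbTE (k0 _ (leqnn f))) rfj eqxx ltr01.
- apply/card_le1_eqP => j k; rewrite !inE !mxE !pnatr_eq1 !eqb1.
  by move=> /eqP -> /eqP[] /val_inj.
Qed.

Lemma packing_row_mx_of (R : realType) p q (X : 'M[R]_(p, q)) :
  packing_matrix X ->
  exists2 r, restricted_growth p q r & X = row_mx_of R p q r.
Proof.
move=> [X01 Xlex Xrow].
(* The default 0 serves both for empty rows and for indices outside the matrix. *)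
pose r i := if insub i is Some i' then
  if [pick j : 'I_q | X i' j == 1] is Some j then j.+1 else 0%N else 0%N.
have rE (i : 'I_p) (j : 'I_q) : (X i j == 1) = (r i == j.+1).
  rewrite /r valK; case: pickP => [j' /eqP Xj'|-> //].
  rewrite eqSS; apply/eqP/eqP => [Xj|/val_inj <- //].
  have /card_le1_eqP/(_ j' j) := Xrow i.
  by rewrite !inE Xj Xj' eqxx => ->.
have XE : X = row_mx_of R p q r.
  apply/matrixP => i j; rewrite mxE -rE.
  by case: (X01 i j) => ->; rewrite ?eqxx// eq_sym oner_eq0.
exists r => //.
move=> i lt_ip; pose i' := Ordinal lt_ip.
have [->//|] := posnP (r i); rewrite -[r i]/(r i').
case ri: (r i') => [//|j] _.
have lt_jq : (j < q)%N.
  move: ri; rewrite /r valK; case: pickP => // j' _ [<-]; exact: ltn_ord.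
rewrite leq_min lt_jq andbT ltnS leqNgt; apply/negP => lt_uj.
(* If row [i] skipped the first unopened column [k], columns [k] and [j] would both vanish above row
   [i] and only [j] would have a 1-entry there, violating the order. *)
pose k := Ordinal (ltn_trans lt_uj lt_jq); pose j' := Ordinal lt_jq.
have := Xlex k j' (ltnW lt_uj); apply/negP; rewrite -ltNge.
apply/ltxi_tuplePlt; exists i' => [l lt_li|].
  rewrite !tnth_mktuple XE !mxE.
  have /= := used_ge r lt_li; do 2 case: eqP => //=; lia.
rewrite !tnth_mktuple XE !mxE ri eqxx /= eqSS.
case: eqP => [|_]; last exact: ltr01.
lia.
Qed.

(** * Linear objectives on packing matrices and on their convex hull *)

Lemma inner_row_mx_of (R : realType) p q (d : {ffun cell p q -> R})
    (w : nat -> nat -> R) r :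
  (forall c : cell p q, d c = w (val c).1 (val c).2) ->
  restricted_growth p q r ->
  inner d (restrict (row_mx_of R p q r)) = \sum_(i < p) gain (w i) (r i).
Proof.
move=> dE gr; rewrite /inner.
pose F (ij : 'I_p * 'I_q) : R := w ij.1 ij.2 * (r ij.1 == ij.2.+1)%:R.
transitivity (\sum_(c : cell p q) F (val c)).
  by apply: eq_bigr => c _; rewrite ffunE mxE dE.
rewrite -(big_sub [pred ij : 'I_p * 'I_q | ij.2 <= ij.1]%N F) big_mkcond /=.
transitivity (\sum_ij F ij).
  (* Above the diagonal [w] is arbitrary, but the matrix entry vanishes there by the growth
     condition. *)
  apply: eq_bigr => -[i j] _; rewrite inE /F /=; case: leqP => // lt_ij.
  case: eqP => [rij|_]; last by rewrite mulr0.
  have := gr _ (ltn_ord i); have := used_le_index gr (ltnW (ltn_ord i)); lia.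
rewrite -(pair_bigA _ (fun i j => F (i, j))) /=; apply: eq_bigr => i _.
have := gr _ (ltn_ord i); case ri: (r i) => [|j] le_r /=.
  by rewrite big1// => j _; rewrite /F /= ri mulr0.
have lt_jq : (j < q)%N by lia.
rewrite (bigD1 (Ordinal lt_jq)) //= {1}/F /= ri eqxx mulr1 big1 ?addr0// => k.
rewrite -val_eqE /= /F /= ri eqSS eq_sym => /negbTE ->; exact: mulr0.
Qed.

(** The half-space cut out by the bound at [x] is convex and contains all packing matrices, hence
    also their hull. *)
Lemma orbitope_maximizes (R : realType) p q (d x : {ffun cell p q -> R}) X :
  packing_matrix X -> x = restrict X ->
  (forall Y, packing_matrix Y -> inner d (restrict Y) <= inner d x) ->
  maximizes d (packing_orbitope R p q) x.
Proof.
move=> pX -> max_x; split; first by exists X => //; apply: sub_gen_smallest.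
move=> _ [Y + <-]; move: Y.
apply: (@smallest_sub _ (@convex_set R 'M[R]_(p, q)) _
  [set Y | inner d (restrict Y) <= inner d (restrict X)]%classic) => //.
move=> Y Z t; rewrite !inE /= => leY leZ.
have -> : inner d (restrict (conv t Y Z)) =
    t%:num * inner d (restrict Y) + (1 - t%:num) * inner d (restrict Z).
  rewrite /inner !mulr_sumr -big_split /=; apply: eq_bigr => c _.
  rewrite !ffunE [X in _ * X = _](_ : _ = t%:num * Y (val c).1 (val c).2 +
    (1 - t%:num) * Z (val c).1 (val c).2); last by rewrite !mxE.
  by rewrite mulrDr !(mulrCA (d c)).
have -> : inner d (restrict X) = t%:num * inner d (restrict X) +
    (1 - t%:num) * inner d (restrict X) by rewrite -mulrDl addrC subrK mul1r.
by rewrite lerD// ler_wpM2l// subr_ge0.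
Qed.

(** * Running times *)

(** Total correctness: termination, a time bound and a postcondition in one predicate, so that time
    bounds compose along with invariants. *)
Definition runs (R : realType) (c : cmd) (s : state R) (T : nat)
    (Q : state R -> Prop) : Prop :=
  exists t s', [/\ exec c s t s', (t <= T)%N & Q s'].

Fixpoint loop_free (c : cmd) : bool :=
  match c with
  | Seq c1 c2 | If _ c1 c2 => loop_free c1 && loop_free c2
  | While _ _ => false
  | _ => true
  end.

(* The values of [run] and [max_cost] at a loop are junk. *)
Fixpoint run (R : realType) (c : cmd) (s : state R) : state R :=
  match c with
  | Skip | While _ _ => s
  | NSet x e => set_nvar s x (neval s e)
  | NPut a i e => set_narr s a (neval s i) (neval s e)
  | RSet x e => set_rvar s x (reval s e)
  | RPut a i e => set_rarr s a (neval s i) (reval s e)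
  | Seq c1 c2 => run c2 (run c1 s)
  | If b c1 c2 => if beval s b then run c1 s else run c2 s
  end.

Fixpoint max_cost (c : cmd) : nat :=
  match c with
  | Skip | While _ _ => 1
  | NSet _ e => (ncost e).+1
  | NPut _ i e => (ncost i + ncost e).+1
  | RSet _ e => (rcost e).+1
  | RPut _ i e => (ncost i + rcost e).+1
  | Seq c1 c2 => max_cost c1 + max_cost c2
  | If b c1 c2 => (bcost b + maxn (max_cost c1) (max_cost c2)).+1
  end.

(** Loop-free code always terminates: its effect is found by evaluation, and the dearer branch of
    each test bounds its cost. *)
Lemma runs_loop_free (R : realType) c (s : state R) (Q : state R -> Prop) :
  loop_free c -> Q (run c s) -> runs c s (max_cost c) Q.
Proof.
move=> lf_c Qs.
suff [t E le_t] : exists2 t, exec c s t (run c s) & (t <= max_cost c)%N.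
  by exists t, (run c s).
elim: c s lf_c {Qs} => //=; try by move=> *; eexists; [constructor|].
- move=> c1 IH1 c2 IH2 s.
  move=> /andP[/(IH1 s)[t1 E1 le1] /(IH2 (run c1 s))[t2 E2 le2]].
  exists (t1 + t2)%N; [exact: exec_Seq E1 E2 | exact: leq_add].
- move=> b c1 IH1 c2 IH2 s /andP[/(IH1 s)[t1 E1 le1] /(IH2 s)[t2 E2 le2]].
  case sb: (beval s b).
    by exists (bcost b + t1).+1; [constructor; rewrite sb|lia].
  by exists (bcost b + t2).+1; [constructor; rewrite sb|lia].
Qed.

Lemma runs_Seq (R : realType) c1 c2 (s : state R) T1 T2
    (P Q : state R -> Prop) :
  runs c1 s T1 P -> (forall s', P s' -> runs c2 s' T2 Q) ->
  runs (Seq c1 c2) s (T1 + T2) Q.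
Proof.
move=> [t1 [s1 [E1 le1 /[swap] H]]] /H[t2 [s2 [E2 le2 Qs]]].
by exists (t1 + t2)%N, s2; split; [exact: exec_Seq E1 E2|exact: leq_add|].
Qed.

Lemma runs_loop_free_Seq (R : realType) c1 c2 (s : state R) T
    (Q : state R -> Prop) :
  loop_free c1 -> runs c2 (run c1 s) T Q ->
  runs (Seq c1 c2) s (max_cost c1 + T) Q.
Proof.
move=> lf_c1 H; apply: (@runs_Seq _ _ _ _ _ _ (fun t => t = run c1 s)).
  exact: runs_loop_free.
by move=> _ ->.
Qed.

(** The invariant is indexed by the number of completed rounds, and the guard must hold exactly
    before round [n] is reached. The last summand pays for the final, failing test. *)
Lemma runs_While (R : realType) b c (s : state R) T n
    (I : nat -> state R -> Prop) :
  (forall i s, (i <= n)%N -> I i s -> beval s b = (i < n)%N) ->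
  (forall i s, (i < n)%N -> I i s -> runs c s T (I i.+1)) ->
  I 0%N s -> runs (While b c) s (n * (T + bcost b).+1 + (bcost b).+1) (I n).
Proof.
move=> guard body I0.
suff H m i s' : (i + m = n)%N -> I i s' ->
    runs (While b c) s' (m * (T + bcost b).+1 + (bcost b).+1) (I n).
  exact: H I0.
elim: m i s' => [|m IH] i s' inm Is.
  exists (bcost b).+1, s'; split; rewrite ?mul0n //; last by rewrite -inm addn0.
  by apply: exec_WhileF; rewrite (guard i)//; lia.
have lt_in : (i < n)%N by lia.
have [t1 [s1 [E1 le1 I1]]] := body _ _ lt_in Is.
have [|t2 [s2 [E2 le2 I2]]] := IH i.+1 s1 _ I1; first by lia.
exists (bcost b + t1 + t2).+1, s2; split=> //; last by rewrite mulSn; lia.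
by apply: exec_WhileT E1 E2; rewrite (guard i)// ltnW.
Qed.

Lemma runs_weaken (R : realType) c (s : state R) T T' (P Q : state R -> Prop) :
  (T <= T')%N -> (forall s', P s' -> Q s') -> runs c s T P -> runs c s T' Q.
Proof.
move=> leT PQ [t [s' [E le_t Ps]]].
by exists t, s'; split=> //; [exact: leq_trans leT|exact: PQ].
Qed.

(** * The algorithm *)

Local Notation vp := 0%N (only parsing).
Local Notation vq := 1%N (only parsing).
Local Notation vi := 2%N (only parsing).
Local Notation vbase := 3%N (only parsing).
Local Notation vk := 4%N (only parsing).
Local Notation vlog := 5%N (only parsing).
Local Notation vbest := 6%N (only parsing).
Local Notation vused := 7%N (only parsing).
Local Notation vrow := 8%N (only parsing).
Local Notation xgain := 0%N (only parsing).
Local Notation apick := 0%N (only parsing).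
Local Notation ain := 0%N (only parsing).
Local Notation aout := 1%N (only parsing).
Local Notation aval := 2%N (only parsing).

Definition incr (x : nat) : cmd := NSet x (NAdd (NVar x) (NConst 1)).

Definition nlt (e f : nexp) : bexp := NLe (NAdd e (NConst 1)) f.

(** The product [p * q] is obtained by repeated addition, as the machine does not multiply
    naturals. *)
Definition base_loop : cmd :=
  While (nlt (NVar vi) (NVar vp))
    (Seq (NSet vbase (NAdd (NVar vbase) (NVar vq))) (incr vi)).

Definition init_loop : cmd :=
  While (NLe (NVar vk) (NVar vq)) (Seq (RPut aval (NVar vk) RZero) (incr vk)).

Definition keep_best : cmd :=
  Seq (NPut apick (NVar vlog) (NVar vbest))
      (RPut aval (NVar vk) (RAdd (RGet aval (NVar vk)) (RVar xgain))).

Definition input_entry : rexp := RGet ain (NAdd (NVar vbase) (NVar vk)).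

Definition open_entry : rexp :=
  RAdd (RGet aval (NAdd (NVar vk) (NConst 1))) input_entry.

(** In round [k], [vbest] and [xgain] describe the first [k] columns; column [k] joins them only
    after the decision for [k] is logged. For [k = q] no column is left to open. *)
Definition dp_body : cmd :=
  Seq
    (If (nlt (NVar vk) (NVar vq))
       (Seq
         (If (RLe (RAdd (RGet aval (NVar vk)) (RVar xgain)) open_entry)
            (Seq (NPut apick (NVar vlog) (NAdd (NVar vk) (NConst 1)))
                 (RPut aval (NVar vk) open_entry))
            keep_best)
         (If (RLe (RVar xgain) input_entry)
            (Seq (RSet xgain input_entry)
                 (NSet vbest (NAdd (NVar vk) (NConst 1))))
            Skip))
       keep_best)
    (Seq (incr vlog) (incr vk)).

Definition dp_loop : cmd := While (NLe (NVar vk) (NVar vq)) dp_body.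

Definition dp_start : cmd :=
  Seq (NSet vi (NSub (NVar vi) (NConst 1)))
    (Seq (NSet vbase (NSub (NVar vbase) (NVar vq)))
      (Seq (NSet vk (NConst 0))
        (Seq (NSet vbest (NConst 0)) (RSet xgain RZero)))).

(* The decision for row [p - n.+1] with [k] columns used is logged at position
   [n * q.+1 + k], so [output_loop] walks through the log backwards. *)
Definition rows_loop : cmd :=
  While (NLe (NConst 1) (NVar vi)) (Seq dp_start dp_loop).

(** Two comparisons express the equality of [vrow] and [vk + 1]. *)
Definition write_body : cmd :=
  Seq
    (If (BAnd (NLe (NVar vrow) (NAdd (NVar vk) (NConst 1)))
              (NLe (NAdd (NVar vk) (NConst 1)) (NVar vrow)))
       (RPut aout (NVar vbase) ROne)
       (RPut aout (NVar vbase) RZero))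
    (Seq (incr vbase) (incr vk)).

Definition write_loop : cmd := While (nlt (NVar vk) (NVar vq)) write_body.

Definition write_start : cmd :=
  Seq (NSet vlog (NSub (NVar vlog) (NAdd (NVar vq) (NConst 1))))
    (Seq (NSet vrow (NGet apick (NAdd (NVar vlog) (NVar vused))))
         (NSet vk (NConst 0))).

Definition write_finish : cmd :=
  Seq (If (NLe (NVar vused) (NVar vrow)) (NSet vused (NVar vrow)) Skip)
      (incr vi).

Definition output_loop : cmd :=
  While (nlt (NVar vi) (NVar vp))
    (Seq write_start (Seq write_loop write_finish)).

Definition orbitope_opt : cmd :=
  Seq (Seq (NSet vi (NConst 0)) (NSet vbase (NConst 0)))
    (Seq base_loop
      (Seq (NSet vk (NConst 0))
        (Seq init_loop
          (Seq (NSet vlog (NConst 0))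
            (Seq rows_loop
              (Seq (NSet vused (NConst 0)) output_loop)))))).

(** * Correctness and running time of the loops *)

Lemma base_loop_correct (R : realType) (s : state R) p q w :
  nvar s vp = p -> nvar s vq = q -> nvar s vi = 0%N -> nvar s vbase = 0%N ->
  rarr s ain = w ->
  runs base_loop s (p * 14 + 6)
    (fun s => [/\ nvar s vp = p, nvar s vq = q, nvar s vi = p,
                  nvar s vbase = (p * q)%N & rarr s ain = w]).
Proof.
move=> sp sq si sb sw; rewrite /base_loop.
(* The body costs 4 + 4 and the guard 5, which gives 14 per round and 6 for the last test. *)
apply: (@runs_While _ _ _ _ 8 p (fun i s =>
  [/\ nvar s vp = p, nvar s vq = q, nvar s vi = i, nvar s vbase = (i * q)%N
    & rarr s ain = w])) => //=.
  by move=> i s' _ [-> _ -> _ _]; rewrite addn1.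
move=> i s' lt_i [s'p s'q s'i s'b s'w].
apply: runs_loop_free => //=; rewrite /upd /=.
by split=> //; rewrite ?s'i ?s'b ?s'q; lia.
Qed.

Lemma init_loop_correct (R : realType) (s : state R) p q b w :
  nvar s vp = p -> nvar s vq = q -> nvar s vi = p -> nvar s vbase = b ->
  rarr s ain = w -> nvar s vk = 0%N ->
  runs init_loop s (q.+1 * 11 + 4)
    (fun s => [/\ nvar s vp = p, nvar s vq = q, nvar s vi = p,
                  nvar s vbase = b & rarr s ain = w] /\
              forall k, (k <= q)%N -> rarr s aval k = 0).
Proof.
move=> sp sq si sb sw sk; rewrite /init_loop.
pose I k (s : state R) :=
  [/\ nvar s vp = p, nvar s vq = q, nvar s vi = p, nvar s vbase = b
    & rarr s ain = w] /\
  (nvar s vk = k /\ forall k', (k' < k)%N -> rarr s aval k' = 0).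
apply: (@runs_weaken _ _ _ _ _ (I q.+1)); last first.
- apply: (@runs_While _ _ _ _ 7 q.+1) => [k s'|k s' _|] //=.
    by move=> _ [[_ s'q _ _ _] [s'k _]]; rewrite s'k s'q.
  move=> [[s'p s'q s'i s'b s'w] [s'k Z]].
  apply: runs_loop_free => //=; rewrite /upd /=; split=> //=.
  split=> [|k'] /=; rewrite s'k ?addn1// ltnS leq_eqVlt.
  by rewrite /upd /=; case: eqP => //= _ lt_k'; apply: Z.
- by move=> s' [H [_ Z]]; split=> // k; apply: Z.
- by [].
Qed.

(* The inner loop overwrites the value function [U] of the rows below by that
   of the current row while reading it: entry [k] depends only on [U k] and
   [U k.+1]. *)
Lemma dp_loop_correct (R : realType) (s : state R) p q i b x A (w U : nat -> R)
    (F : nat -> nat) :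
  nvar s vp = p -> nvar s vq = q -> nvar s vi = i -> nvar s vbase = b ->
  rarr s ain = A ->
  nvar s vk = 0%N -> nvar s vlog = x -> nvar s vbest = 0%N ->
  rvar s xgain = 0 ->
  (forall j, (j < q)%N -> A (b + j)%N = w j) ->
  (forall k, (k <= q)%N -> rarr s aval k = U k) ->
  (forall k, (k <= q)%N -> F (x + k)%N = best_row q w U k) ->
  (forall z, (z < x)%N -> narr s apick z = F z) ->
  runs dp_loop s (q.+1 * 65 + 4)
    (fun s => [/\ [/\ nvar s vp = p, nvar s vq = q, nvar s vi = i,
                  nvar s vbase = b & rarr s ain = A],
                  nvar s vlog = (x + q.+1)%N,
                  forall k, (k <= q)%N -> rarr s aval k = bellman q w U k
                & forall z, (z < x + q.+1)%N -> narr s apick z = F z]).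
Proof.
move=> sp sq si sb sA sk sx sm sg wE UE FE sF; rewrite /dp_loop.
(* Entries below [k] are new and those from [k] on are old. The running maximum is claimed only for
   [k <= q], since the last round no longer updates it. *)
pose I k (s : state R) :=
  [/\ [/\ nvar s vp = p, nvar s vq = q, nvar s vi = i, nvar s vbase = b
      & rarr s ain = A],
      [/\ nvar s vk = k, nvar s vlog = (x + k)%N,
          (k <= q)%N -> nvar s vbest = best_used w k
        & (k <= q)%N -> rvar s xgain = gain w (best_used w k)],
      forall k', (k' < k)%N -> rarr s aval k' = bellman q w U k',
      forall k', (k <= k' <= q)%N -> rarr s aval k' = U k'
    & forall z, (z < x + k)%N -> narr s apick z = F z].
have body k s' : (k <= q)%N -> I k s' -> runs dp_body s' 61 (I k.+1).
  move=> le_kq [[s'p s'q s'i s'b s'A] [s'k s'x s'm s'g] W1 W2 C].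
  have {}s'm := s'm le_kq; have {}s'g := s'g le_kq.
  have maxm : maxn k (best_used w k) = k by have := best_used_le w k; lia.
  have maxk : maxn k k.+1 = k.+1 by lia.
  have Uk : rarr s' aval k = U k by apply: W2; lia.
  have [rP rW rC rB rG] : [/\
      [/\ [/\ nvar (run dp_body s') vp = p, nvar (run dp_body s') vq = q,
          nvar (run dp_body s') vi = i & nvar (run dp_body s') vbase = b],
          rarr (run dp_body s') ain = A, nvar (run dp_body s') vk = k.+1
        & nvar (run dp_body s') vlog = (x + k.+1)%N],
      rarr (run dp_body s') aval = upd (rarr s' aval) k (bellman q w U k),
      narr (run dp_body s') apick =
        upd (narr s' apick) (x + k) (best_row q w U k),
      (k < q)%N -> nvar (run dp_body s') vbest = best_used w k.+1
    & (k < q)%N -> rvar (run dp_body s') xgain = gain w (best_used w k.+1)].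
    rewrite /dp_body /keep_best /open_entry /input_entry /= s'k s'q addn1.
    rewrite /bellman /best_row; case: ltnP => lt_kq /=; last first.
      by rewrite /upd /= s'k s'x s'm s'g Uk maxm !addn1 addnS.
    (* Position [k.+1] still holds the old value, because overwriting proceeds upwards. *)
    have U1 : rarr s' aval k.+1 = U k.+1 by apply: W2; lia.
    rewrite ?s'k s'b s'A s'g Uk wE// ?addn1 U1.
    case: (leP (U k + gain w (best_used w k)) (U k.+1 + w k)) => _ /=;
    rewrite /upd /= ?s'k ?s'b ?s'A ?s'g ?wE//;
    case: (leP (gain w (best_used w k)) (w k)) => _;
    rewrite /= ?s'k ?s'x ?s'm ?s'g ?s'b ?s'A ?maxk ?maxm ?addn1 ?addnS ?wE//;
    by split=> //; rewrite /upd /= s'k s'x.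
  apply: (@runs_weaken _ _ _ (max_cost dp_body) _ (I k.+1)) => //.
  apply: runs_loop_free => //; split.
  - by case: rP => -[-> -> -> ->] ->.
  - by case: rP => _ _ -> ->.
  - move=> k'; rewrite ltnS leq_eqVlt rW /upd.
    by case: eqP => [-> //|_ /= lt_k']; apply: W1.
  - move=> k' /andP[lt_k le_k']; rewrite rW /upd.
    by case: eqP => [|_]; [lia|apply: W2; lia].
  - move=> z; rewrite addnS ltnS leq_eqVlt rC /upd.
    by case: eqP => [-> _|_ /= lt_z]; [rewrite FE|apply: C].
apply: (@runs_weaken _ _ _ (q.+1 * 65 + 4) _ (I q.+1)) => //.
  by move=> s' [H [_ s'x _ _] W _ C]; split.
apply: (@runs_While _ _ _ _ 61 q.+1) => //.
  by move=> k s' _ [[_ s'q _ _ _] [s'k _ _ _] _ _ _]; rewrite /= s'k s'q.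
split=> // [|z]; first by split; rewrite ?addn0.
by rewrite addn0; apply: sF.
Qed.

(** Each round is one Bellman step: after [n] rounds, [aval] holds the value function of the last
    [n] rows and the log their decisions. *)
Lemma rows_loop_correct (R : realType) (s : state R) p q A w :
  nvar s vp = p -> nvar s vq = q -> nvar s vi = p ->
  nvar s vbase = (p * q)%N -> rarr s ain = A -> nvar s vlog = 0%N ->
  (forall k, (k <= q)%N -> rarr s aval k = 0) ->
  (forall i j, (i < p)%N -> (j < q)%N -> A (i * q + j)%N = w i j) ->
  runs rows_loop s (p * (q.+1 * 65 + 24) + 4)
    (fun s => [/\ nvar s vp = p, nvar s vq = q, nvar s vi = 0%N &
                  nvar s vbase = 0%N] /\
              (nvar s vlog = (p * q.+1)%N /\
              forall n k, (n < p)%N -> (k <= q)%N ->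
                narr s apick (n * q.+1 + k)%N = policy p q w n k)).
Proof.
move=> sp sq si sb sA sx s0 wE; rewrite /rows_loop.
(* Log positions are decoded by Euclidean division, each block having [q.+1] entries. *)
pose F z := policy p q w (z %/ q.+1) (z %% q.+1).
have FE n k : (k <= q)%N -> F (n * q.+1 + k)%N = policy p q w n k.
  by move=> le_kq; rewrite /F divnMDl// modnMDl divn_small// modn_small// addn0.
pose I n (s : state R) :=
  [/\ [/\ nvar s vp = p, nvar s vq = q, nvar s vi = (p - n)%N,
      nvar s vbase = ((p - n) * q)%N & rarr s ain = A],
      nvar s vlog = (n * q.+1)%N,
      forall k, (k <= q)%N -> rarr s aval k = value p q w n k
    & forall z, (z < n * q.+1)%N -> narr s apick z = F z].
apply: (@runs_weaken _ _ _ _ _ (I p)); last first.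
- apply: (@runs_While _ _ _ _ (14 + (q.+1 * 65 + 4)) p) => //.
  + by move=> n s' le_n [[_ _ s'i _ _] _ _ _]; rewrite /= s'i; lia.
  + move=> n s' lt_n [[s'p s'q s'i s'b s'A] s'x W C].
    apply: runs_loop_free_Seq => //.
    apply: (runs_weaken (leqnn _)); last first.
      apply: (@dp_loop_correct _ _ p q (p - n.+1) ((p - n.+1) * q) (n * q.+1) A
        (w (p - n.+1)%N) (value p q w n) F) => //=.
      * rewrite /upd /= s'i; lia.
      * rewrite /upd /= s'b s'q -{2}[q]mul1n -mulnBl; congr (_ * _)%N; lia.
      * by move=> j lt_j; apply: wE => //; lia.
      * by move=> k le_k; rewrite FE.
    move=> s1 [H H1 H2 H3]; split=> //.
    * by rewrite H1 mulSn addnC.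
    * by move=> z; rewrite mulSn addnC; apply: H3.
  + by split; rewrite ?subn0.
- move=> s' [[s'p s'q s'i s'b _] s'x _ C].
  split; first by rewrite s'i s'b subnn.
  split=> // n k lt_n le_k; rewrite C ?FE//.
  rewrite (@leq_trans (n.+1 * q.+1))// ?leq_mul2r ?lt_n ?orbT//.
  by rewrite mulSn addnC ltn_add2r ltnS.
- by rewrite /=; lia.
Qed.

Lemma write_loop_correct (R : realType) (s : state R) p q i b u r x C
    (O : nat -> R) :
  nvar s vp = p -> nvar s vq = q -> nvar s vi = i -> nvar s vbase = b ->
  nvar s vused = u -> nvar s vrow = r -> nvar s vlog = x ->
  narr s apick = C -> nvar s vk = 0%N ->
  (forall j, (j < q)%N -> O (b + j)%N = (r == j.+1)%:R) ->
  (forall z, (z < b)%N -> rarr s aout z = O z) ->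
  runs write_loop s (q * 29 + 6)
    (fun s => [/\ [/\ nvar s vp = p, nvar s vq = q, nvar s vi = i &
                       nvar s vbase = (b + q)%N],
                  [/\ nvar s vused = u, nvar s vrow = r, nvar s vlog = x
                    & narr s apick = C]
                & forall z, (z < b + q)%N -> rarr s aout z = O z]).
Proof.
move=> sp sq si sb su sr sx sC sk OE sO; rewrite /write_loop.
pose I k (s : state R) :=
  [/\ [/\ nvar s vp = p, nvar s vq = q, nvar s vi = i, nvar s vk = k &
                       nvar s vbase = (b + k)%N],
                  [/\ nvar s vused = u, nvar s vrow = r, nvar s vlog = x
                    & narr s apick = C]
                & forall z, (z < b + k)%N -> rarr s aout z = O z].
apply: (@runs_weaken _ _ _ _ _ (I q)); last first.
- apply: (@runs_While _ _ _ _ 23 q) => //.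
  + by move=> k s' _ [[_ s'q _ s'k _] _ _]; rewrite /= s'k s'q addn1.
  + move=> k s' lt_k [[s'p s'q s'i s'k s'b] [s'u s'r s'x s'C] s'O].
    apply: (@runs_weaken _ _ _ (max_cost write_body) _ (I k.+1)) => //.
    apply: runs_loop_free => //; rewrite /write_body /= s'k s'r addn1 -eqn_leq.
    have Ok := OE _ lt_k.
    split; [by case: eqP => _ /=; rewrite /upd /= ?s'k ?s'b ?addn1 ?addnS
           |by case: eqP => _ /=|].
    move=> z; rewrite addnS ltnS leq_eqVlt.
    case: eqP Ok => _ /= Ok; rewrite /upd /= s'b;
      by case: eqP => [-> //|_ /= lt_z]; apply: s'O.
  + by split; rewrite ?addn0// => z; rewrite addn0; apply: sO.
- by move=> s' [[H1 H2 H3 _ H4] H5 H6].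
- by [].
Qed.

(** The decisions are replayed from the top row, with [vused] following [opt_used]. *)
Lemma output_loop_correct (R : realType) (s : state R) p q
    (w : nat -> nat -> R) :
  nvar s vp = p -> nvar s vq = q -> nvar s vi = 0%N -> nvar s vbase = 0%N ->
  nvar s vused = 0%N -> nvar s vlog = (p * q.+1)%N ->
  (forall n k, (n < p)%N -> (k <= q)%N ->
    narr s apick (n * q.+1 + k)%N = policy p q w n k) ->
  runs output_loop s (p * (q * 29 + 40) + 6)
    (fun s => forall i j, (i < p)%N -> (j < q)%N ->
      rarr s aout (i * q + j)%N = (opt_row p q w i == j.+1)%:R).
Proof.
move=> sp sq si sb su sx sC; rewrite /output_loop.
pose O z : R := (opt_row p q w (z %/ q) == (z %% q).+1)%:R.
have OE i j : (j < q)%N -> O (i * q + j)%N = (opt_row p q w i == j.+1)%:R.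
  move=> lt_j; have q_gt0 : (0 < q)%N by lia.
  by rewrite /O divnMDl// modnMDl divn_small// modn_small// addn0.
pose I i (s' : state R) :=
  [/\ [/\ nvar s' vp = p, nvar s' vq = q, nvar s' vi = i &
           nvar s' vbase = (i * q)%N],
      [/\ nvar s' vused = opt_used p q w i, nvar s' vlog = ((p - i) * q.+1)%N
        & narr s' apick = narr s apick]
    & forall z, (z < i * q)%N -> rarr s' aout z = O z].
apply: (@runs_weaken _ _ _ _ _ (I p)); last first.
- apply: (@runs_While _ _ _ _
    (max_cost write_start + ((q * 29 + 6) + max_cost write_finish)) p) => //.
  + by move=> i s' _ [[s'p _ s'i _] _ _]; rewrite /= s'i s'p addn1.
  + move=> i s' lt_i [[s'p s'q s'i s'b] [s'u s'x s'C] s'O].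
    apply: runs_loop_free_Seq => //.
    (* Row [i] has [p - i.+1] rows below it, so stepping back by [q.+1] reaches the start of its
       block in the log. *)
    have x1 : ((p - i) * q.+1 - q.+1 = (p - i.+1) * q.+1)%N.
      by rewrite -{2}[q.+1]mul1n -mulnBl; congr (_ * _)%N; lia.
    apply: runs_Seq.
      apply: (@write_loop_correct _ _ p q i (i * q) (opt_used p q w i)
        (opt_row p q w i) ((p - i.+1) * q.+1) (narr s apick) O) => //=.
      * rewrite /upd /= s'x s'u s'C s'q addn1 x1 sC//; last exact: opt_used_le.
        lia.
      * by rewrite /upd /= s'x s'q addn1 x1.
      * by move=> j; apply: OE.
    move=> s1 [[s1p s1q s1i s1b] [s1u s1r s1x s1C] s1O].
    apply: runs_loop_free => //=; rewrite s1u s1r.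
    split.
    * by case: ifP => _; rewrite /= /upd /= ?s1i ?s1b addn1 mulSn addnC.
    * case: ifP => le_u; rewrite /= /upd /= ?s1u ?s1r; split=> //.
      -- exact/esym/maxn_idPr.
      -- by apply/esym/maxn_idPl/ltnW; rewrite ltnNge; apply/negbT.
    * by move=> z lt_z; case: ifP => _; rewrite /= /upd /=; apply: s1O; lia.
  + by split; rewrite ?subn0.
- move=> s' [_ _ s'O] i j lt_i lt_j; rewrite s'O ?OE//.
  rewrite (@leq_trans (i.+1 * q))// ?leq_mul2r ?lt_i ?orbT//.
  by rewrite mulSn addnC ltn_add2r.
- by rewrite /=; lia.
Qed.

Theorem corollary7 (R : realType) :
  exists (A : cmd) (C : nat),
    forall p q : nat, (1 <= q)%N -> (q <= p)%N ->
    forall (d : {ffun cell p q -> R}) (s : state R), is_input d s ->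
    exists (t : nat) (s' : state R),
      [/\ exec A s t s',
          (t <= C * (p * q))%N
        & maximizes d (packing_orbitope R p q) (output p q s')].
Proof.
(* The loop bounds add up to [94pq + 143p + 11q + 41], at most [289pq] because [p], [q] and 1 are at
   most [pq]. *)
exists orbitope_opt, 300%N => p q q_gt0 le_qp d s [sp sq sd].
(* These weights agree with [d] on the cells and are whatever the memory contains elsewhere. *)
pose w i j := rarr s ain (i * q + j)%N.
have gr : restricted_growth p q (opt_row p q w) by exact: opt_row_growth.
suff [t [s' [E le_t out]]] : runs orbitope_opt s (300 * (p * q))
    (fun s => forall i j, (i < p)%N -> (j < q)%N ->
      rarr s aout (i * q + j)%N = (opt_row p q w i == j.+1)%:R).
  exists t, s'; split=> //.
  have outE : output p q s' = restrict (row_mx_of R p q (opt_row p q w)).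
    by apply/ffunP => c; rewrite !ffunE mxE out.
  apply: (orbitope_maximizes (row_mx_of_packing R gr)) => // Y.
  move=> /packing_row_mx_of[r gr' ->]; rewrite outE.
  by rewrite !(@inner_row_mx_of _ _ _ _ w) ?opt_row_optimal// => c; rewrite -sd.
apply: (@runs_weaken _ _ _ (4 + ((p * 14 + 6) + (2 + ((q.+1 * 11 + 4) +
  (2 + ((p * (q.+1 * 65 + 24) + 4) + (2 + (p * (q * 29 + 40) + 6))))))))) => //.
  have : (p <= p * q)%N by rewrite leq_pmulr.
  have : (q <= p * q)%N by rewrite leq_pmull// (leq_trans q_gt0).
  lia.
  by move=> s' H; exact: H.
apply: runs_loop_free_Seq => //.
apply: runs_Seq; first exact: (@base_loop_correct _ _ p q (rarr s ain)).
move=> s1 [s1p s1q s1i s1b s1A].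
apply: runs_loop_free_Seq => //; apply: runs_Seq.
  exact: (@init_loop_correct _ _ p q (p * q) (rarr s ain)).
move=> s2 [[s2p s2q s2i s2b s2A] s2W].
apply: runs_loop_free_Seq => //; apply: runs_Seq.
  exact: (@rows_loop_correct _ _ p q (rarr s ain) w).
move=> s3 [[s3p s3q s3i s3b] [s3x s3C]].
by apply: runs_loop_free_Seq => //; apply: output_loop_correct.
Qed.
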